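(* Let $R$ be a finite ring with unity and $\alpha,x\in R$. If $\mathcal{M}_R((x)_\ell)$ is a minimal subset of itself, then $$C_\alpha(x)=\mu_R(K,(x)_\ell)\,\frac{|[x]_\ell|}{\varphi_R(K,(x)_\ell)},$$ where $K$ is the largest left ideal of $R$ contained in $(x)_\ell\cap\langle\alpha\rangle^\perp$.
   Context: Rings are associative with unity, not necessarily commutative. $(x)_\ell$ is the left ideal generated by $x$ and $[x]_\ell=\{y\in R:(y)_\ell=(x)_\ell\}$. Identify $(R,+)$ with $\mathbb{Z}_{n_1}\times\cdots\times\mathbb{Z}_{n_k}$, write $x=(x_1,\dots,x_k)$, and for $\alpha\in R$ let $\psi_\alpha(x)=\prod_{j=1}^k\omega_{n_j}^{\alpha_jx_j}$ with $\omega_n=e^{2\pi i/n}$. Define $C_\alpha(x)=\sum_{s\in[x]_\ell}\psi_\alpha(s)$. $\langle\alpha\rangle$ is the cyclic additive subgroup generated by $\alpha$, and $S^\perp=\{y\in R:\psi_s(y)=1\ \forall s\in S\}$. For a left ideal $J$, a maximal $R$-left ideal of $J$ is a left ideal $M$ of $R$ with $M\subsetneq J$ and no left ideal $L$ of $R$ with $M\subsetneq L\subsetneq J$; $\mathcal{M}_R(J)$ is the set of these and $\mathcal{M}_R(J,I)$ is the set of those containing a given left ideal $I$. The empty intersection $\bigcap_{M\in\emptyset}M$ is $J$. A subset $\mathcal{M}_1\subseteq\mathcal{M}_R(J)$ is a minimal subset of itself if $\bigcap_{M\in E}M\neq\bigcap_{M\in\mathcal{M}_1}M$ for every proper subset $E\subsetneq\mathcal{M}_1$.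 For left ideals $I\subseteq J$: $\mu_R(I,J)=1$ if $I=J$; if $I\ne J$ and $I=\bigcap_{M\in E}M$ for some nonempty $E\subseteq\mathcal{M}_R(J)$, $\mu_R(I,J)=e-o$, where $e$ (resp. $o$) is the number of subsets $E\subseteq\mathcal{M}_R(J)$ of even (resp. odd) cardinality with $\bigcap_{M\in E}M=I$; otherwise $\mu_R(I,J)=0$. When $\mathcal{M}_R(J)$ is a minimal subset of itself, $\varphi_R(I,J)=1$ if $I=J$; $\varphi_R(I,J)=\prod_{M\in\mathcal{M}_R(J,I)}\left(\frac{|J|}{|M|}-1\right)$ if $I\ne J$ is an intersection of some maximal $R$-left ideals of $J$; and $\varphi_R(I,J)=1$ otherwise. *)

(* Defs.v *)
From HB Require Import structures.
From mathcomp Require Import all_boot all_order all_algebra all_fingroup.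
From mathcomp Require Import reals trigo.
From mathcomp Require Import complex.

Set Implicit Arguments.
Unset Strict Implicit.
Unset Printing Implicit Defensive.

Import Order.TTheory GRing.Theory Num.Theory.
Local Open Scope ring_scope.

Section LeftIdeals.
Variable R : finPzRingType.
Implicit Types (x y : R) (I J L M K S : {set R}) (E : {set {set R}}).

Definition left_ideal I : bool :=
  [&& 0 \in I, [forall x in I, forall y in I, x + y \in I]
    & [forall r : R, forall x in I, r * x \in I]].

Lemma left_idealP I :
  reflect (@submod_closed R R^o (mem I)) (left_ideal I).
Proof.
apply: (iffP and3P) => [[I0 /forall_inP ID /forallP IM]|[I0 IL]].
  split=> // r x y xI yI.
  by apply: (forall_inP (ID _ _)) => //; apply: (forall_inP (IM r)).
split=> //.
  apply/forall_inP => x xI; apply/forall_inP => y yI.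
  by have := IL 1 x y xI yI; rewrite scale1r.
apply/forallP => r; apply/forall_inP => x xI.
by have := IL r x 0 xI I0; rewrite addr0.
Qed.

Definition left_gen x : {set R} :=
  \bigcap_(I : {set R} | left_ideal I && (x \in I)) I.

Lemma left_genE x : left_gen x = [set r * x | r : R].
Proof.
apply/eqP; rewrite eqEsubset; apply/andP; split.
  apply: bigcap_inf; apply/andP; split; last first.
    by apply/imsetP; exists 1; rewrite ?mul1r.
  apply/left_idealP; split.
    by apply/imsetP; exists 0; rewrite ?mul0r.
  move=> r _ _ /imsetP[a _ ->] /imsetP[b _ ->].
  apply/imsetP; exists (r * a + b) => //.
  by rewrite mulrDl -mulrA.
apply/subsetP => _ /imsetP[r _ ->]; apply/bigcapP => I /andP[/and3P[_ _ IM] xI].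
by apply: (forall_inP (forallP IM r)).
Qed.

Definition left_class x : {set R} := [set y | left_gen y == left_gen x].

Definition maximal_left_ideals J : {set {set R}} :=
  [set M | [&& left_ideal M, M \proper J &
    ~~ [exists L : {set R},
         [&& left_ideal L, M \proper L & L \proper J]]]].

Definition maximal_left_ideals_over J I : {set {set R}} :=
  [set M in maximal_left_ideals J | I \subset M].

(* Intersecting with J only matters for the empty family, whose intersection
   is J by convention. *)
Definition inter_in J E : {set R} := J :&: \bigcap_(M in E) M.

Definition minimal_subset_of_itself J E : Prop :=
  forall E' : {set {set R}}, E' \proper E -> inter_in J E' <> inter_in J E.

Definition is_inter_of_maximals I J : bool :=
  [exists E : {set {set R}},
     [&& E != set0, E \subset maximal_left_ideals J & inter_in J E == I]].

Definition families_with_inter I J : {set {set {set R}}} :=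
  [set E : {set {set R}} |
     (E \subset maximal_left_ideals J) && (inter_in J E == I)].

Definition mu I J : int :=
  if I == J then 1
  else if is_inter_of_maximals I J then
    #|[set E in families_with_inter I J | ~~ odd #|E| ]|%:Z
    - #|[set E in families_with_inter I J | odd #|E| ]|%:Z
  else 0.

(* Total in J; only meaningful when [maximal_left_ideals J] is a minimal subset
   of itself. *)
Definition phi I J : rat :=
  if I == J then 1
  else if is_inter_of_maximals I J then
    \prod_(M in maximal_left_ideals_over J I) (#|J|%:R / #|M|%:R - 1)
  else 1.

Definition largest_left_ideal_in S K : Prop :=
  [/\ left_ideal K, K \subset S &
      forall L : {set R}, left_ideal L -> L \subset S -> L \subset K].

Lemma largest_left_ideal_in_exists S :
  0 \in S -> {in S &, forall x y, x + y \in S} ->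
  exists K, largest_left_ideal_in S K.
Proof.
move=> S0 SD; pose K := [set x | left_gen x \subset S].
have inK x r : x \in K -> r * x \in S.
  rewrite inE => /subsetP; apply.
  by rewrite left_genE; apply/imsetP; exists r.
have Kin x : (forall r, r * x \in S) -> x \in K.
  by move=> xS; rewrite inE left_genE; apply/subsetP => _ /imsetP[r _ ->].
exists K; split.
- apply/left_idealP; split=> [|r x y xK yK].
    by apply: Kin => r; rewrite mulr0.
  apply: Kin => s; rewrite mulrDr; apply: SD; last exact: inK.
  by rewrite mulrA; exact: inK.
- by apply/subsetP => x xK; rewrite -[x]mul1r; exact: inK.
- move=> L /and3P[_ _ LM] LS; apply/subsetP => x xL; apply: Kin => r.
  by apply: (subsetP LS); apply: (forall_inP (forallP LM r)).
Qed.

End LeftIdeals.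

Definition omega (F : realType) (n : nat) : F[i] :=
  Complex (cos (2 * pi / n%:R)) (sin (2 * pi / n%:R)).

(* An identification of V with Z_{n_1} x ... x Z_{n_k}.  The moduli are stored
   as their predecessors: 'I_n.+1 carries the group structure of Z_{n+1} for
   every n, whereas 'Z_n is Z_n only for 1 < n. *)
Record cyclic_decomposition (V : finZmodType) := CyclicDecomposition {
  cd_rank : nat;
  cd_pred : 'I_cd_rank -> nat;
  cd_coord : forall j : 'I_cd_rank, {additive V -> 'I_(cd_pred j).+1};
  cd_bij : bijective (fun x : V =>
    [ffun j => cd_coord j x] : {dffun forall j, 'I_(cd_pred j).+1})
}.
Arguments cd_pred {V} c j.
Arguments cd_coord {V} c j.

Section Characters.
Variables (F : realType) (R : finPzRingType) (D : cyclic_decomposition R).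
Implicit Types (alpha x y : R) (S : {set R}).

Definition psi alpha x : F[i] :=
  \prod_(j < cd_rank D)
    omega F (cd_pred D j).+1 ^+ (cd_coord D j alpha * cd_coord D j x)%N.

Definition char_sum alpha x : F[i] := \sum_(s in left_class x) psi alpha s.

Definition perp S : {set R} := [set y | [forall s in S, psi s y == 1]].

Lemma omega_unity n : omega F n.+1 ^+ n.+1 = 1.
Proof.
have deMoivre m (t : F) :
    (Complex (cos t) (sin t)) ^+ m = Complex (cos (t *+ m)) (sin (t *+ m)).
  elim: m => [|m IHm]; first by rewrite expr0 mulr0n cos0 sin0.
  rewrite exprS IHm mulrS cosD sinD; apply/eqP; rewrite eq_complex /=.
  by rewrite eqxx addrC eqxx.
rewrite deMoivre; have <- : pi *+ 2 = (2 * pi / n.+1%:R : F) *+ n.+1.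
  by rewrite -[RHS]mulr_natr divfK ?pnatr_eq0 // mulr_natl.
by rewrite cos2pi sin2pi.
Qed.

Lemma psiD alpha : {morph psi alpha : x y / x + y >-> x * y}.
Proof.
move=> x y; rewrite /psi -big_split /=; apply: eq_bigr => j _.
rewrite raddfD -exprD -mulnDr /= !(mulnC (cd_coord _ _ _ : nat)).
by rewrite -(expr_mod _ (omega_unity _)) modnMml expr_mod ?omega_unity.
Qed.

Lemma psi0 alpha : psi alpha 0 = 1.
Proof. by rewrite /psi big1 // => j _; rewrite raddf0 /= muln0. Qed.

Lemma largest_left_ideal_in_perp_exists x S :
  exists K, largest_left_ideal_in (left_gen x :&: perp S) K.
Proof.
apply: largest_left_ideal_in_exists.
  rewrite inE inE left_genE; apply/andP; split.
    by apply/imsetP; exists 0; rewrite ?mul0r.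
  by apply/forall_inP => s _; rewrite psi0.
move=> y z /setIP[yx yS] /setIP[zx zS]; rewrite inE; apply/andP; split.
  move: yx zx; rewrite left_genE => /imsetP[a _ ->] /imsetP[b _ ->].
  by apply/imsetP; exists (a + b); rewrite ?mulrDl.
move: yS zS; rewrite !inE => /forall_inP yS /forall_inP zS.
apply/forall_inP => s sS.
by rewrite psiD (eqP (yS _ sS)) (eqP (zS _ sS)) mulr1.
Qed.

End Characters.

Definition additive_cycle (V : finZmodType) (a : V) : {set V} := <[a]>%g.

Lemma additive_cycleP (V : finZmodType) (a b : V) :
  reflect (exists n : nat, b = a *+ n) (b \in additive_cycle a).
Proof. exact: cycleP. Qed.

(* Main.v *)
(* Let J = (x)_l and w(M) = |M|/|J|.  Since [x]_l is J minus the union of its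
   maximal left ideals, inclusion-exclusion writes C_alpha(x) as the sum of
   (-1)^|E| * sum_(s in cap E) psi_alpha(s) over the sets E of maximal left
   ideals; the inner sum is |cap E| if cap E is contained in K and 0 otherwise.
   Minimality makes E |-> cap E injective and gives
   |cap E| = |J| * prod_(M in E) w(M), because cap E and any M outside E are
   comaximal.  If K contains the intersection of all maximal left ideals, then
   K = cap A for A the set of those containing K, so the sum ranges over E
   containing A and factors as
   |J| * prod_(M in A) (- w(M)) * prod_(M notin A) (1 - w(M)), while
   |[x]_l| = |J| * prod_M (1 - w(M)).  Otherwise both sides vanish. *)
Require Import Defs.
From mathcomp Require Import all_boot all_order all_algebra all_fingroup.
From mathcomp Require Import reals trigo complex.

Set Implicit Arguments.
Unset Strict Implicit.
Unset Printing Implicit Defensive.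

Import Order.TTheory GRing.Theory Num.Theory.
Local Open Scope ring_scope.

(** * Expansion of products over subsets, and the order of a sumset *)

(** Expand a product over all of [T] of two-term factors: the term for [i] in [E] is [f i] on [B]
    and 0 off [B], the term for [i] outside [E] is 0 on [A] and 1 off [A]. A set [E] that misses a
    point of [A] or leaves [B] picks up a zero factor. *)
Lemma sum_prod_subsets (C : comPzRingType) (T : finType) (A B : {set T})
    (f : T -> C) : A \subset B ->
  \sum_(E : {set T} | (A \subset E) && (E \subset B)) \prod_(i in E) f i
  = \prod_(i in A) f i * \prod_(i in B :\: A) (1 + f i).
Proof.
move=> sAB.
have -> : \prod_(i in A) f i * \prod_(i in B :\: A) (1 + f i)
    = \prod_i ((if i \in B then f i else 0) + (if i \in A then 0 else 1)).
  rewrite [X in X * _]big_mkcond [X in _ * X]big_mkcond -big_split /=.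
  apply: eq_bigr => i _; rewrite inE; case: (boolP (i \in A)) => [iA | _] /=.
    by rewrite (subsetP sAB) // addr0 mulr1.
  by case: (i \in B); rewrite mul1r ?add0r // addrC.
rewrite [RHS]bigA_distr /=.
rewrite [LHS]big_mkcond; apply: eq_bigr => E _ /=; case: ifPn.
  case/andP=> sAE sEB; rewrite big_mkcond; apply: eq_bigr => i _.
  case: ifPn => [iE | niE]; first by rewrite (subsetP sEB).
  by rewrite (contraNF (subsetP sAE i) niE).
rewrite negb_and; case/orP; case/subsetPn=> i; last first.
  by move=> iE niB; rewrite (bigD1 i) //= iE (negbTE niB) mul0r.
by move=> iA niE; rewrite (bigD1 i) //= (negbTE niE) iA mul0r.
Qed.

(** In a finite group, a subset containing 0 and closed under addition is a subgroup, so the product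
    formula for subgroups applies. *)
Lemma card_sumset (V : finZmodType) (A B : {set V}) :
    addr_closed (mem A) -> addr_closed (mem B) ->
  (#|A| * #|B| = #|[set (y + z)%R | y in A, z in B]| * #|A :&: B|)%N.
Proof.
move=> [A0 AD] [B0 BD].
have gA : group_set A by apply/group_setP.
have gB : group_set B by apply/group_setP.
exact: (mul_cardG (Group gA) (Group gB)).
Qed.

(** * Left ideals and intersections of families *)

Section LeftIdeals.
Variable R : finPzRingType.
Implicit Types (x y : R) (I J K L M : {set R}) (E : {set {set R}}).

Lemma left_ideal0 I : left_ideal I -> 0 \in I.
Proof. by case/and3P. Qed.

Lemma left_idealD I x y : left_ideal I -> x \in I -> y \in I -> x + y \in I.
Proof. by case/and3P=> _ /forall_inP ID _ xI; apply: (forall_inP (ID x xI)). Qed.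

Lemma left_idealM I r x : left_ideal I -> x \in I -> r * x \in I.
Proof. by case/and3P=> _ _ /forallP IM; apply: (forall_inP (IM r)). Qed.

Lemma left_idealB I x y : left_ideal I -> x \in I -> y \in I -> x - y \in I.
Proof.
by move=> idI xI yI; rewrite -mulN1r left_idealD // left_idealM.
Qed.

Lemma left_ideal_add I L : left_ideal I -> left_ideal L ->
  left_ideal [set y + z | y in I, z in L].
Proof.
move=> idI idL; apply/left_idealP; split=> [|r _ _ /imset2P[a b aI bL ->] /imset2P[c d cI dL ->]].
  by rewrite -[X in X \in _]addr0 imset2_f ?left_ideal0.
by rewrite scalerDr addrACA imset2_f ?left_idealD ?left_idealM.
Qed.

Lemma left_ideal_left_gen x : left_ideal (left_gen x).
Proof.
apply/left_idealP; split=> [|r y z].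
  by apply/bigcapP => I /andP[/left_ideal0].
move=> /bigcapP yx /bigcapP zx; apply/bigcapP => I xI.
have /andP[idI _] := xI.
by rewrite left_idealD ?left_idealM ?yx ?zx.
Qed.

Lemma mem_left_gen x : x \in left_gen x.
Proof. by apply/bigcapP => I /andP[]. Qed.

Lemma left_gen_sub I x : left_ideal I -> (left_gen x \subset I) = (x \in I).
Proof.
move=> idI; apply/subsetP/idP => [|xI]; first by apply; apply: mem_left_gen.
by move=> y /bigcapP; apply; rewrite idI.
Qed.

Lemma inter_inP J E y :
  reflect (y \in J /\ forall M, M \in E -> y \in M) (y \in inter_in J E).
Proof.
apply: (iffP setIP) => -[yJ yE]; split=> //; last exact/bigcapP.
by move=> M ME; apply: (bigcapP yE).
Qed.

Lemma inter_inS J E E' : E \subset E' -> inter_in J E' \subset inter_in J E.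
Proof.
move=> sEE'; apply/subsetP => y /inter_inP[yJ yE']; apply/inter_inP.
by split=> // M ME; apply: yE'; apply: (subsetP sEE').
Qed.

Lemma inter_in_sub J E M : M \in E -> inter_in J E \subset M.
Proof. by move=> ME; apply/subsetP => y /inter_inP[_]; apply. Qed.

Lemma sub_inter_in J E I : I \subset J -> (forall M, M \in E -> I \subset M) ->
  I \subset inter_in J E.
Proof.
move=> sIJ sIE; apply/subsetP => y yI; apply/inter_inP.
by split=> [|M ME]; [apply: (subsetP sIJ) | apply: (subsetP (sIE M ME))].
Qed.

Lemma inter_in0 J : inter_in J set0 = J.
Proof. by rewrite /inter_in big_set0 setIT. Qed.

(** * Maximal left ideals of a left ideal [J] *)

Section Maximals.
Variable J : {set R}.
Hypothesis idJ : left_ideal J.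
Local Notation Max := (maximal_left_ideals J).

Lemma maximal_left_ideal M : M \in Max -> left_ideal M.
Proof. by rewrite inE => /and3P[]. Qed.

Lemma maximal_proper M : M \in Max -> M \proper J.
Proof. by rewrite inE => /and3P[]. Qed.

Lemma exists_maximal L : left_ideal L -> L \proper J ->
  exists2 M, M \in Max & L \subset M.
Proof.
move=> idL ltLJ.
pose P := [pred M : {set R} | left_ideal M && (M \proper J)].
have [|M /maxsetP[/andP[idM ltMJ] maxM] sLM] := @maxset_exists _ P L.
  exact/andP.
exists M; rewrite // inE idM ltMJ /=.
apply/existsP => -[N /and3P[idN ltMN ltNJ]].
have eqNM : N = M by apply: maxM (proper_sub ltMN); apply/andP.
by rewrite eqNM properxx in ltMN.
Qed.

Lemma left_ideal_inter_in E : E \subset Max -> left_ideal (inter_in J E).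
Proof.
move=> /subsetP sE; have idE M : M \in E -> left_ideal M.
  by move/sE/maximal_left_ideal.
apply/left_idealP; split=> [|r y z /inter_inP[yJ yE] /inter_inP[zJ zE]].
  by apply/inter_inP; split=> [|M /idE]; apply: left_ideal0.
apply/inter_inP; split=> [|M ME]; first by rewrite left_idealD ?left_idealM.
by rewrite left_idealD ?left_idealM ?idE ?yE ?zE.
Qed.

(** The sum [L + M] is a left ideal inside [J] that strictly contains [M], so it cannot be proper in
    [J]. *)
Lemma comaximal M L : M \in Max -> left_ideal L -> L \subset J ->
  ~~ (L \subset M) -> [set y + z | y in L, z in M] = J.
Proof.
move=> maxM idL sLJ nsLM; have idM := maximal_left_ideal maxM.
have sMJ := proper_sub (maximal_proper maxM).
apply/eqP; rewrite eqEsubset; apply/andP; split.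
  apply/subsetP => _ /imset2P[y z yL zM ->].
  by apply: left_idealD => //; [apply: (subsetP sLJ) | apply: (subsetP sMJ)].
apply: contraTT maxM => nsJ; rewrite inE !negb_and !negbK; apply/or3P.
apply: Or33; apply/existsP; exists [set y + z | y in L, z in M].
rewrite left_ideal_add //= !properE nsJ !andbT -andbA; apply/and3P; split.
- apply/subsetP => z zM; rewrite -[z]add0r.
  by rewrite imset2_f ?left_ideal0.
- apply: contra nsLM => /subsetP sM; apply/subsetP => y yL.
  by apply: sM; rewrite -[y]addr0 imset2_f ?left_ideal0.
- apply/subsetP => _ /imset2P[y z yL zM ->].
  by apply: left_idealD => //; [apply: (subsetP sLJ) | apply: (subsetP sMJ)].
Qed.

Lemma card_inter_maximal M L : M \in Max -> left_ideal L -> L \subset J ->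
  ~~ (L \subset M) -> (#|L :&: M| * #|J| = #|L| * #|M|)%N.
Proof.
move=> maxM idL sLJ nsLM; have idM := maximal_left_ideal maxM.
rewrite [RHS]card_sumset ?comaximal 1?mulnC //; split; do ?exact: left_ideal0.
  by move=> y z; apply: left_idealD.
by move=> y z; apply: left_idealD.
Qed.

(** * Consequences of minimality: families of maximal left ideals and their intersections *)

Hypothesis minMax : minimal_subset_of_itself J Max.

(** If [M] is not in [E], the intersection over [Max :\ M] already lies in [M], so dropping [M] from
    [Max] does not change the total intersection, against minimality. *)
Lemma inter_in_subset E M : E \subset Max -> M \in Max ->
  (inter_in J E \subset M) = (M \in E).
Proof.
move=> sE maxM; apply/idP/idP => [sEM|]; last exact: inter_in_sub.
apply: contraT => nME; case: (minMax (properD1 maxM)).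
apply/eqP; rewrite eqEsubset; apply/andP; split; last first.
  exact/inter_inS/subD1set.
apply: sub_inter_in => [|N maxN]; first exact: subsetIl.
have [-> | neNM] := eqVneq N M; last by apply/inter_in_sub/setD1P.
by apply: subset_trans sEM; apply: inter_inS; rewrite subsetD1 sE.
Qed.

Lemma inter_in_subset_inter E E' : E \subset Max -> E' \subset Max ->
  (inter_in J E \subset inter_in J E') = (E' \subset E).
Proof.
move=> sE sE'; apply/idP/idP => [sEE'|]; last exact: inter_inS.
apply/subsetP => M ME'; rewrite -inter_in_subset ?(subsetP sE') //.
exact: subset_trans sEE' (inter_in_sub _ _).
Qed.

Lemma inter_in_inj : {in [pred E : {set {set R}} | E \subset Max] &,
  injective (inter_in J)}.
Proof.
move=> E E' sE sE' eqI; apply/eqP; rewrite eqEsubset.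
by rewrite -(inter_in_subset_inter sE sE') -(inter_in_subset_inter sE' sE)
  eqI subxx.
Qed.

(* With P the intersection of the maximal left ideals not containing K,
   irredundancy forces K + P = J; the modular law then yields the claim. *)
Lemma inter_maximals_over K : left_ideal K -> K \subset J ->
  inter_in J Max \subset K -> inter_in J (maximal_left_ideals_over J K) = K.
Proof.
move=> idK sKJ sRK; set A := maximal_left_ideals_over J K.
have sA : A \subset Max by apply/subsetP => M; rewrite inE => /andP[].
have sT : Max :\: A \subset Max by apply: subsetDl.
set P := inter_in J (Max :\: A).
have idP : left_ideal P := left_ideal_inter_in sT.
have eqKP : [set y + z | y in K, z in P] = J.
  apply/eqP; rewrite eqEproper; apply/andP; split.
    apply/subsetP => _ /imset2P[y z yK /inter_inP[zJ _] ->].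
    by rewrite left_idealD // (subsetP sKJ).
  apply/negP => /(exists_maximal (left_ideal_add idK idP))[M maxM sM].
  have sKM : K \subset M.
    apply: subset_trans sM; apply/subsetP => y yK.
    by rewrite -[y]addr0 imset2_f ?left_ideal0.
  have : P \subset M.
    apply: subset_trans sM; apply/subsetP => y yP.
    by rewrite -[y]add0r imset2_f ?left_ideal0.
  by rewrite inter_in_subset // => /setDP[_]; rewrite inE maxM sKM.
apply/eqP; rewrite eqEsubset andbC sub_inter_in //; last first.
  by move=> M; rewrite inE => /andP[].
apply/subsetP => n nA; have /inter_inP[nJ _] := nA.
move: (nJ); rewrite -eqKP => /imset2P[k p kK pP def_n].
have kA : k \in inter_in J A.
  apply/inter_inP; split=> [|M]; first exact: (subsetP sKJ).
  by rewrite inE => /andP[_ /subsetP]; apply.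
rewrite def_n left_idealD // (subsetP sRK) //; apply/inter_inP.
have /inter_inP[pJ pT] := pP; split=> // M maxM.
case: (boolP (M \in A)) => [MA | nMA]; last by apply: pT; rewrite inE nMA.
have /inter_inP[_] : p \in inter_in J A; last exact.
have -> : p = n - k by rewrite def_n addrC addKr.
exact: left_idealB (left_ideal_inter_in sA) nA kA.
Qed.

Lemma maximal_left_ideals_over_inter E : E \subset Max ->
  maximal_left_ideals_over J (inter_in J E) = E.
Proof.
move=> sE; apply/setP => M; rewrite inE; apply/andP/idP => [[maxM] | ME].
  by rewrite inter_in_subset.
by split; [apply: (subsetP sE) | apply: inter_in_sub].
Qed.

Lemma inter_in_eq E : E \subset Max -> (inter_in J E == J) = (E == set0).
Proof.
move=> sE; rewrite -{2}(inter_in0 J); apply/eqP/eqP => [|-> //].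
by apply: inter_in_inj => //; apply: sub0set.
Qed.

Lemma is_inter_of_maximals_inter E : E \subset Max -> E != set0 ->
  is_inter_of_maximals (inter_in J E) J.
Proof. by move=> sE E0; apply/existsP; exists E; rewrite E0 sE eqxx. Qed.

(** By injectivity [E] is the only family with this intersection, so the count of even minus odd
    families has a single term. *)
Lemma mu_inter E : E \subset Max -> mu (inter_in J E) J = (-1) ^+ #|E|.
Proof.
move=> sE; rewrite /mu inter_in_eq //.
have [-> | E0] := eqVneq E set0; first by rewrite cards0.
rewrite is_inter_of_maximals_inter //.
have -> : families_with_inter (inter_in J E) J = [set E].
  apply/setP => E'; rewrite !inE; apply/andP/eqP => [[sE' /eqP] | ->].
    exact: inter_in_inj.
  by rewrite sE eqxx.
have cardE (P : pred {set {set R}}) : #|[set E' in [set E] | P E']| = P E.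
  have -> : [set E' in [set E] | P E'] = if P E then [set E] else set0.
    apply/setP => E'; rewrite !inE; case: eqVneq => [-> | neE] /=.
      by case: (P E); rewrite !inE ?eqxx.
    by case: (P E); rewrite !inE ?(negbTE neE).
  by case: (P E); rewrite ?cards1 ?cards0.
by rewrite (cardE (fun E' => ~~ odd #|E'|)) (cardE (fun E' => odd #|E'|))
  -signr_odd; case: odd.
Qed.

(** The maximal left ideals above the intersection of [E] are the members of [E]; for empty [E] the
    empty product agrees with the value 1 at [I = J]. *)
Lemma phi_inter E : E \subset Max ->
  phi (inter_in J E) J = \prod_(M in E) (#|J|%:R / #|M|%:R - 1).
Proof.
move=> sE; rewrite /phi inter_in_eq //.
have [-> | E0] := eqVneq E set0; first by rewrite big_set0.
by rewrite is_inter_of_maximals_inter // maximal_left_ideals_over_inter.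
Qed.

(** Induction on the size of [E]: the intersection over [E :\ M] is not contained in [M], so by
    comaximality intersecting with [M] scales the order by [#|M| / #|J|]. *)
Lemma card_inter_in (C : numFieldType) E : E \subset Max ->
  #|inter_in J E|%:R = #|J|%:R * \prod_(M in E) (#|M|%:R / #|J|%:R) :> C.
Proof.
have J_neq0 : #|J|%:R != 0 :> C.
  by rewrite pnatr_eq0 -lt0n; apply/card_gt0P; exists 0; apply: left_ideal0.
elim: {E}_.+1 {-2}E (ltnSn #|E|) => // n IHn E leEn sE.
have [-> | [M ME]] := set_0Vmem E; first by rewrite inter_in0 big_set0 mulr1.
have sE'E : E :\ M \subset E by apply: subD1set.
have sE' := subset_trans sE'E sE; have maxM := subsetP sE M ME.
have -> : inter_in J E = inter_in J (E :\ M) :&: M.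
  by rewrite /inter_in (big_setD1 M) //= -setIA [M :&: _]setIC.
rewrite (big_setD1 M) //= mulrCA -IHn //; last first.
  by rewrite (cardsD1 M) ME in leEn.
apply: (mulIf J_neq0); rewrite mulrAC divfK // mulrC -!natrM; congr _%:R.
rewrite mulnC [RHS]mulnC card_inter_maximal ?left_ideal_inter_in //.
  exact: subsetIl.
by rewrite inter_in_subset // !inE eqxx.
Qed.

End Maximals.

(** * Inclusion-exclusion over generators, and character sums over left ideals *)

Lemma mem_left_class x y : (y \in left_class x) =
  (y \in left_gen x) && [forall M in maximal_left_ideals (left_gen x), y \notin M].
Proof.
have idx := left_ideal_left_gen x.
rewrite inE; apply/eqP/andP => [<- | [yx /forall_inP maxy]].
  split; first exact: mem_left_gen.
  apply/forall_inP => M maxM; rewrite -left_gen_sub ?(maximal_left_ideal maxM) //.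
  exact: proper_subn (maximal_proper maxM).
apply/eqP; rewrite eqEproper left_gen_sub // yx /=; apply/negP => lt_yx.
have [M maxM] := exists_maximal (left_ideal_left_gen y) lt_yx.
by rewrite left_gen_sub ?(maximal_left_ideal maxM) // (negbTE (maxy M maxM)).
Qed.

(** On [J], the indicator of [left_class x] is the product over the maximal [M] of one minus the
    indicator of [M]; it is expanded over subsets of [Max]. *)
Lemma sum_left_class (C : comPzRingType) (f : R -> C) x :
  \sum_(s in left_class x) f s =
  \sum_(E : {set {set R}} | E \subset maximal_left_ideals (left_gen x))
    (-1) ^+ #|E| * \sum_(s in inter_in (left_gen x) E) f s.
Proof.
set J := left_gen x; set Max := maximal_left_ideals J.
pose g s (M : {set R}) : C := - (s \in M)%:R.
transitivity (\sum_(E : {set {set R}} | E \subset Max)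
    \sum_(s in J) (\prod_(M in E) g s M) * f s); last first.
  apply: eq_bigr => E sE; rewrite mulr_sumr big_mkcond [RHS]big_mkcond.
  apply: eq_bigr => s _; rewrite prodrN.
  case: (boolP (s \in J)) => [sJ | nsJ]; last first.
    by rewrite inE (negbTE nsJ).
  case: ifPn => [/inter_inP[_ sE'] | ns].
    by rewrite big1 ?mulr1 // => M ME; rewrite sE'.
  have [M ME nsM] : exists2 M, M \in E & s \notin M.
    apply/exists_inP; rewrite -negb_forall_in; apply: contra ns => /forall_inP sE'.
    exact/inter_inP.
  by rewrite (bigD1 M) //= (negbTE nsM) mul0r mulr0 mul0r.
rewrite exchange_big /= big_mkcond [RHS]big_mkcond; apply: eq_bigr => s _.
rewrite mem_left_class -/J -/Max; case: (s \in J) => //=; rewrite -mulr_suml.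
have -> : \sum_(E : {set {set R}} | E \subset Max) \prod_(M in E) g s M
    = \prod_(M in Max) (1 + g s M).
  have := sum_prod_subsets (g s) (sub0set Max).
  rewrite big_set0 mul1r setD0 => <-.
  by apply: eq_bigl => E; rewrite sub0set.
case: ifPn => [/forall_inP maxs | ].
  by rewrite big1 ?mul1r // => M maxM; rewrite /g (negbTE (maxs M maxM)) subr0.
rewrite negb_forall_in => /exists_inP[M maxM]; rewrite negbK => sM.
by rewrite (bigD1 M) //= /g sM subrr !mul0r.
Qed.

(** If [chi t] differs from 1 for some [t] in [L], translation by [t] permutes [L], so [chi t - 1]
    annihilates the sum. *)
Lemma sum_character (C : idomainType) (chi : R -> C) L :
    left_ideal L -> chi 0 = 1 -> {morph chi : y z / y + z >-> y * z} ->
  \sum_(s in L) chi s = if [forall s in L, chi s == 1] then #|L|%:R else 0.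
Proof.
move=> idL chi0 chiD; case: ifPn => [/forall_inP chi1 | ].
  by rewrite -sumr_const; apply: eq_bigr => s /chi1/eqP.
rewrite negb_forall_in => /exists_inP[t tL chit_neq1].
apply: (mulfI (_ : chi t - 1 != 0)); first by rewrite subr_eq0.
rewrite mulr0 mulrBl mul1r mulr_sumr [X in _ - X](reindex_inj (addrI t)) /=.
apply/eqP; rewrite subr_eq0; apply/eqP; apply: eq_big => [s | s _].
  apply/idP/idP => [sL | tsL]; first exact: left_idealD.
  by rewrite -[s](addKr t) addrC left_idealB.
by rewrite chiD.
Qed.

End LeftIdeals.

(** * The pairing [psi] and the orthogonal of a cyclic subgroup *)

Lemma psiC (F : realType) (R : finPzRingType) (D : cyclic_decomposition R)
    (a y : R) : psi F D a y = psi F D y a.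
Proof. by apply: eq_bigr => j _; rewrite mulnC. Qed.

Lemma psiMn (F : realType) (R : finPzRingType) (D : cyclic_decomposition R)
    (a y : R) n : psi F D (a *+ n) y = psi F D a y ^+ n.
Proof.
rewrite psiC [in RHS]psiC; elim: n => [|n IHn]; first by rewrite psi0.
by rewrite mulrS psiD IHn exprS.
Qed.

Lemma mem_perp_cycle (F : realType) (R : finPzRingType)
    (D : cyclic_decomposition R) (a y : R) :
  (y \in perp F D (additive_cycle a)) = (psi F D a y == 1).
Proof.
rewrite inE; apply/forall_inP/eqP => [perp_y | psi1 _ /additive_cycleP[n ->]].
  by apply/eqP/perp_y/additive_cycleP; exists 1%N.
by rewrite psiMn psi1 expr1n.
Qed.

(** * Evaluation of the character sum *)

Theorem theorem4p5 (F : realType) (R : finPzRingType)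
    (D : cyclic_decomposition R) (alpha x : R) (K : {set R}) :
  minimal_subset_of_itself (left_gen x) (maximal_left_ideals (left_gen x)) ->
  largest_left_ideal_in (left_gen x :&: perp F D (additive_cycle alpha)) K ->
  char_sum F D alpha x =
    (mu K (left_gen x))%:~R
    * (#|left_class x|%:R / ratr (phi K (left_gen x))).
Proof.
set J := left_gen x; set Max := maximal_left_ideals J => minMax [idK sKJp maxK].
have idJ : left_ideal J := left_ideal_left_gen x.
move: sKJp; rewrite subsetI => /andP[sKJ sKp].
pose w (M : {set R}) : F[i] := #|M|%:R / #|J|%:R.
have card_pos (I : {set R}) : left_ideal I -> (0 < #|I|)%N.
  by move=> idI; apply/card_gt0P; exists 0; apply: left_ideal0.
have J_neq0 : #|J|%:R != 0 :> F[i] by rewrite pnatr_eq0 -lt0n card_pos.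
have sumE (E : {set {set R}}) : E \subset Max ->
    (-1) ^+ #|E| * #|inter_in J E|%:R = #|J|%:R * \prod_(M in E) - w M :> F[i].
  by move=> sE; rewrite card_inter_in // prodrN mulrCA.
have sum_class : #|left_class x|%:R = #|J|%:R * \prod_(M in Max) (1 - w M) :> F[i].
  have := sum_prod_subsets (fun M => - w M) (sub0set Max).
  rewrite big_set0 mul1r setD0 => <-.
  rewrite -sumr_const sum_left_class mulr_sumr; apply: eq_big => E.
    by rewrite sub0set.
  by move=> sE; rewrite sumr_const sumE.
have sum_psi : char_sum F D alpha x = #|J|%:R * \sum_(E : {set {set R}} |
    (E \subset Max) && (inter_in J E \subset K)) \prod_(M in E) - w M.
  rewrite /char_sum sum_left_class mulr_sumr big_mkcondr /=.
  apply: eq_bigr => E sE; have idE := left_ideal_inter_in idJ sE.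
  rewrite sum_character ?psi0 //; last exact: psiD.
  (* The intersection is itself a left ideal inside [J], so if [psi alpha] is trivial on it, the
     choice of [K] as largest forces it into [K]. *)
  have -> : [forall s in inter_in J E, psi F D alpha s == 1]
      = (inter_in J E \subset K).
    apply/forall_inP/idP => [psi1 | sEK s sE1]; last first.
      by rewrite -mem_perp_cycle (subsetP sKp) // (subsetP sEK).
    apply: maxK => //; rewrite subsetI subsetIl; apply/subsetP => s /psi1.
    by rewrite mem_perp_cycle.
  by case: ifP => _; rewrite ?mulr0 ?sumE.
rewrite sum_psi; case: (boolP (inter_in J Max \subset K)) => [sRK | nsRK].
  set A := maximal_left_ideals_over J K.
  have sA : A \subset Max by apply/subsetP => M; rewrite inE => /andP[].
  have defK : inter_in J A = K by apply: inter_maximals_over.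
  have -> : \sum_(E : {set {set R}} | (E \subset Max) && (inter_in J E \subset K))
        \prod_(M in E) - w M
      = \prod_(M in A) - w M * \prod_(M in Max :\: A) (1 - w M).
    rewrite -sum_prod_subsets //; apply: eq_bigl => E.
    case: (boolP (E \subset Max)) => sE; rewrite ?andbF //= andbT.
    by rewrite -defK inter_in_subset_inter.
  rewrite -defK mu_inter // phi_inter // sum_class rmorph_sign prodrN.
  rewrite [\prod_(M in Max) _](big_setID A) /= (setIidPr sA) rmorph_prod.
  (* Since [1 - w M = w M * (#|J| / #|M| - 1)], the part of the class size indexed by [A] contains
     the factor [phi], which then cancels. *)
  have -> : \prod_(M in A) (1 - w M) =
      \prod_(M in A) w M * \prod_(M in A) ratr (#|J|%:R / #|M|%:R - 1) :> F[i].
    rewrite -big_split /=; apply: eq_bigr => M MA.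
    have idM := maximal_left_ideal (subsetP sA M MA).
    rewrite rmorphB rmorph1 fmorph_div !rmorph_nat mulrBr mulr1 /w mulrA divfK //.
    by rewrite divff // pnatr_eq0 -lt0n card_pos.
  (* Each [M] is proper in [J], so no factor vanishes and the division is genuine. *)
  have phi_neq0 : \prod_(M in A) ratr (#|J|%:R / #|M|%:R - 1) != 0 :> F[i].
    apply/prodf_neq0 => M MA; have maxM := subsetP sA M MA.
    have M_gt0 := card_pos M (maximal_left_ideal maxM).
    rewrite fmorph_eq0 subr_eq0 -(inj_eq (mulIf (_ : #|M|%:R != 0 :> rat))).
      rewrite divfK ?mul1r ?pnatr_eq0 -?lt0n // eqr_nat.
      by rewrite gtn_eqF // proper_card // maximal_proper.
    by rewrite pnatr_eq0 -lt0n.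
  by rewrite [X in _ = _ * (_ * X / _)]mulrAC [X in _ = _ * (X / _)]mulrA
    mulfK // -mulrA mulrCA.
(* Every intersection over a subfamily contains the total one, so none lies in [K] and the sum is
   empty. *)
rewrite big1 ?mulr0 => [|E /andP[sE sEK]]; last first.
  by case/negP: nsRK; apply: subset_trans (inter_inS J sE) sEK.
have neqK (E : {set {set R}}) : E \subset Max -> inter_in J E != K.
  move=> sE; apply: contraNneq nsRK => <-; exact: inter_inS.
(* Writing [J] as the empty intersection lets [neqK] also exclude [K = J], where [mu] would be 1. *)
rewrite /mu -[X in K == X]inter_in0 eq_sym (negbTE (neqK _ (sub0set _))).
case: ifP => [/existsP[E /and3P[_ sE]] | _]; last by rewrite mul0r.
by rewrite (negbTE (neqK E sE)).
Qed.
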